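(* Let $(\mathfrak{g}_0,\sigma;\theta)$ be a non-compact semisimple symmetric pair equipped with a Cartan involution and let $(\mathfrak{g},\theta_1,\theta_2)=(\mathfrak{g}_0,\sigma;\theta)^*$ be the corresponding commutative compact semisimple symmetric triad. Then $(\mathfrak{g}_0,\sigma)$ is irreducible if and only if $(\mathfrak{g},\theta_1,\theta_2)$ is irreducible.
   Context: An involution on a real Lie algebra $\mathfrak{l}$ is an automorphism $\nu$ with $\nu^2=\operatorname{id}$; $\mathfrak{l}^{\pm\nu}$ are its $(\pm1)$-eigenspaces. $(\mathfrak{g}_0,\sigma;\theta)$ consists of a non-compact real semisimple Lie algebra $\mathfrak{g}_0$, an involution $\sigma$ on it and a Cartan involution $\theta$ of $\mathfrak{g}_0$ with $\theta\sigma=\sigma\theta$. Its dual is $(\mathfrak{g}_0,\sigma;\theta)^*:=(\mathfrak{g},\theta_1,\theta_2)$ where $\mathfrak{g}:=\mathfrak{g}_0^{\theta}+\sqrt{-1}\mathfrak{g}_0^{-\theta}\subset(\mathfrak{g}_0)_{\mathbb{C}}$ (a compact semisimple Lie algebra) and $\theta_1:=\theta|_{\mathfrak{g}}$, $\theta_2:=\sigma|_{\mathfrak{g}}$ are restrictions of the $\mathbb{C}$-linear extensions of $\theta,\sigma$; these are commuting involutions. $(\mathfrak{g}_0,\sigma)$ is irreducible if $\mathfrak{g}_0$ has no non-trivial (i.e. different from $\{0\}$ and $\mathfrak{g}_0$) $\sigma$-invariant ideals. $(\mathfrak{g},\theta_1,\theta_2)$ is irreducible if $\mathfrak{g}$ has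 no non-trivial ideals that are both $\theta_1$- and $\theta_2$-invariant. *)

(* Defs.v *)
From HB Require Import structures.
From mathcomp Require Import all_boot all_order all_algebra.
From mathcomp Require Import reals.
From mathcomp.real_closed Require Import complex.

Set Implicit Arguments.
Unset Strict Implicit.
Unset Printing Implicit Defensive.

Import Order.TTheory GRing.Theory Num.Theory.
Import passmx.
Local Open Scope ring_scope.
Local Open Scope lfun_scope.

HB.mixin Record isLieAlgebra (K : fieldType) V of Vector K V := {
  lie : V -> V -> V;
  lie_bilinear : bilinear_for *:%R *:%R lie;
  lie_alt : forall x, lie x x = 0;
  lie_jacobi : forall x y z,
    lie x (lie y z) + lie y (lie z x) + lie z (lie x y) = 0
}.

#[short(type="lieAlgType")]
HB.structure Definition LieAlgebra (K : fieldType) :=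
  { V of isLieAlgebra K V & Vector K V }.

HB.instance Definition _ (K : fieldType) (V : lieAlgType K) :=
  bilinear_isBilinear.Build K V V V *:%R *:%R (@lie K V) lie_bilinear.

Section LieAlgebraTheory.
Variable K : fieldType.

Definition lfun_trace (V : vectType K) (f : 'End(V)) : K :=
  \tr (mxof (vbasis {:V}) (vbasis {:V}) f).

Variable V : lieAlgType K.
Implicit Types (x y z : V) (nu : 'End(V)) (I : {vspace V}).

Lemma lie_anti x y : lie x y = - lie y x.
Proof.
apply/eqP; rewrite -addr_eq0; apply/eqP.
have := lie_alt (x + y); rewrite linearDl !linearDr /= !lie_alt.
by rewrite add0r addr0.
Qed.

HB.instance Definition _ x :=
  GRing.isLinear.Build K V V *:%R (lie x) (lie_bilinear.2 x).

Definition ad x : 'End(V) := linfun (lie x).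

Lemma adE x y : ad x y = lie x y. Proof. by rewrite /ad lfunE. Qed.

Definition killing x y : K := lfun_trace (ad x \o ad y).

(* In characteristic 0: nondegeneracy of the Killing form. *)
Definition semisimple : Prop :=
  forall x, (forall y, killing x y = 0) -> x = 0.

Definition lie_closed I : Prop :=
  forall x y, x \in I -> y \in I -> lie x y \in I.

Definition ideal I : Prop := forall x y, y \in I -> lie x y \in I.

Definition lie_automorphism nu : Prop :=
  bijective nu /\ (forall x y, nu (lie x y) = lie (nu x) (nu y)).

Definition lie_involution nu : Prop :=
  lie_automorphism nu /\ (nu \o nu = \1)%VF.

Definition invariant nu I : Prop := (nu @: I <= I)%VS.

End LieAlgebraTheory.

Arguments semisimple {K} V.

Section RealLieAlgebra.
Variables (R : realType) (V : lieAlgType R).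

(* A semisimple real Lie algebra is compact when its Killing form is negative
   definite. *)
Definition compact_alg : Prop := forall x : V, x != 0 -> killing x x < 0.

Definition cartan_involution (theta : 'End(V)) : Prop :=
  lie_involution theta /\ (forall x, x != 0 -> 0 < - killing x (theta x)).

End RealLieAlgebra.

Arguments compact_alg {R} V.

(* Non-compact only means not compact: compact ideals are allowed. *)
Record ncSymPair (R : realType) := NcSymPair {
  pair_alg :> lieAlgType R;
  pair_sigma : 'End(pair_alg);
  pair_theta : 'End(pair_alg);
  pair_semisimple : semisimple pair_alg;
  pair_noncompact : ~ compact_alg pair_alg;
  pair_sigma_inv : lie_involution pair_sigma;
  pair_theta_cartan : cartan_involution pair_theta;
  pair_commute : pair_theta \o pair_sigma = pair_sigma \o pair_theta
}.

Record compactTriad (R : realType) := CompactTriad {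
  triad_alg :> lieAlgType R;
  triad_theta1 : 'End(triad_alg);
  triad_theta2 : 'End(triad_alg);
  triad_semisimple : semisimple triad_alg;
  triad_compact : compact_alg triad_alg;
  triad_theta1_inv : lie_involution triad_theta1;
  triad_theta2_inv : lie_involution triad_theta2;
  triad_commute : triad_theta1 \o triad_theta2 = triad_theta2 \o triad_theta1
}.

Definition irreducible_pair (R : realType) (P : ncSymPair R) : Prop :=
  forall I : {vspace P}, ideal I -> invariant (pair_sigma P) I ->
    I = 0%VS \/ I = fullv.

Definition irreducible_triad (R : realType) (T : compactTriad R) : Prop :=
  forall I : {vspace T}, ideal I ->
    invariant (triad_theta1 T) I -> invariant (triad_theta2 T) I ->
    I = 0%VS \/ I = fullv.

Section Subalgebra.
Variables (K : fieldType) (V : lieAlgType K) (U : {vspace V}).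

Definition subalg of lie_closed U : Type := subvs_of U.

Variable closedU : lie_closed U.
Local Notation S := (subalg closedU).

HB.instance Definition _ := Vector.copy S (subvs_of U).

Definition sub_lie (u v : S) : S := vsproj U (lie (vsval u) (vsval v)).

Lemma val_sub_lie u v : vsval (sub_lie u v) = lie (vsval u) (vsval v).
Proof. by rewrite vsprojK ?closedU ?subvsP. Qed.

Lemma sub_lie_bilinear : bilinear_for *:%R *:%R sub_lie.
Proof.
split=> u a v w; apply: subvs_inj => /=.
  by rewrite !val_sub_lie linearP linearPl.
by rewrite !val_sub_lie !linearP.
Qed.

Lemma sub_lie_alt u : sub_lie u u = 0.
Proof. by apply: subvs_inj; rewrite val_sub_lie lie_alt linear0. Qed.

Lemma sub_lie_jacobi u v w :
  sub_lie u (sub_lie v w) + sub_lie v (sub_lie w u)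
  + sub_lie w (sub_lie u v) = 0.
Proof.
by apply: subvs_inj; rewrite !raddfD /= !val_sub_lie lie_jacobi.
Qed.

HB.instance Definition _ := isLieAlgebra.Build K S
  sub_lie_bilinear sub_lie_alt sub_lie_jacobi.

End Subalgebra.

(* The complexification of V, as a real Lie algebra together with the action
   cscale of the complex numbers: (x, y) stands for x + sqrt(-1) y.  The
   lemmas cscaleA to cext_cscale say that this is a complex Lie algebra and
   that cext f is the complex-linear extension of f. *)
Section Complexification.
Variables (R : realType) (V : lieAlgType R).

Definition cplx : Type := (V * V)%type.
HB.instance Definition _ := Vector.copy cplx (V * V)%type.

Definition cplx_lie (z w : cplx) : cplx :=
  (lie z.1 w.1 - lie z.2 w.2, lie z.1 w.2 + lie z.2 w.1).

Lemma cplx_lie_bilinear : bilinear_for *:%R *:%R cplx_lie.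
Proof.
split=> -[x1 x2] a [y1 y2] [z1 z2]; congr pair => /=;
  rewrite ?linearPl ?linearPr.
- by rewrite scalerBr opprD addrACA.
- by rewrite scalerDr addrACA.
- by rewrite scalerBr opprD addrACA.
- by rewrite scalerDr addrACA.
Qed.

Lemma cplx_lie_alt z : cplx_lie z z = 0.
Proof.
case: z => x y; congr pair => /=; first by rewrite !lie_alt subr0.
by rewrite [lie x y]lie_anti addNr.
Qed.

Lemma cplx_lie_jacobi z w u :
  cplx_lie z (cplx_lie w u) + cplx_lie w (cplx_lie u z)
  + cplx_lie u (cplx_lie z w) = 0.
Proof.
case: z w u => [a a'] [b b'] [c c']; congr pair => /=;
  rewrite !(linearDr, linearBr, linearNr) /= ?opprD ?addrA.
  rewrite [LHS](ACl ((1*5*9)*(2*8*11)*(3*6*12)*(4*7*10)))/=.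
  by rewrite -!opprD !lie_jacobi !subr0.
rewrite [LHS](ACl ((1*6*11)*(2*7*9)*(3*5*10)*(4*8*12)))/=.
by rewrite !lie_jacobi -!opprD lie_jacobi !addr0 subr0.
Qed.

HB.instance Definition _ := isLieAlgebra.Build R cplx
  cplx_lie_bilinear cplx_lie_alt cplx_lie_jacobi.

Definition cscale (a : R[i]) (z : cplx) : cplx :=
  (complex.Re a *: z.1 - complex.Im a *: z.2,
   complex.Re a *: z.2 + complex.Im a *: z.1).

Lemma cscaleA a b z : cscale a (cscale b z) = cscale (a * b) z.
Proof.
case: a b z => [a a'] [b b'] [x y]; congr pair => /=;
  rewrite !(scalerDl, scalerDr, scaleNr, scalerN, scalerA) ?opprD ?addrA.
  by rewrite [LHS](ACl (1*4*2*3)).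
by rewrite [LHS](ACl (1*4*2*3)).
Qed.

Lemma cscale1 z : cscale 1 z = z.
Proof.
by case: z => x y; congr pair; rewrite /= !scale1r scale0r ?subr0 ?addr0.
Qed.

Lemma cscaleDl a b z : cscale (a + b) z = cscale a z + cscale b z.
Proof.
case: a b z => [a a'] [b b'] [x y]; congr pair => /=.
  by rewrite !scalerDl opprD addrACA.
by rewrite !scalerDl addrACA.
Qed.

Lemma cscale_real (r : R) z : cscale (r%:C)%C z = r *: z.
Proof. by case: z => x y; congr pair; rewrite /= scale0r ?subr0 ?addr0. Qed.

Fact cscale_linear a : linear (cscale a).
Proof.
case: a => a a' r [x y] [x' y']; congr pair => /=.
  by rewrite scalerBr !scalerDr !scalerA ![_ * r]mulrC opprD addrACA.
by rewrite !scalerDr !scalerA ![_ * r]mulrC addrACA.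
Qed.
HB.instance Definition _ a := GRing.isLinear.Build R cplx cplx *:%R (cscale a)
  (cscale_linear a).

Lemma lie_cscalel a (z w : cplx) : lie (cscale a z) w = cscale a (lie z w).
Proof.
case: a z w => a a' [x y] [x' y']; congr pair => /=;
  rewrite !(linearDl, linearNl, linearZl_LR) /= !(scalerN, scalerDr) ?opprD.
  by rewrite !addrA [LHS](ACl (1*3*4*2)).
by rewrite !addrA [LHS](ACl (1*3*4*2)).
Qed.

Lemma lie_cscaler a (z w : cplx) : lie z (cscale a w) = cscale a (lie z w).
Proof. by rewrite lie_anti lie_cscalel [lie w z]lie_anti linearN opprK. Qed.

Definition cplx_in (x : V) : cplx := (x, 0).

Fact cplx_in_linear : linear cplx_in.
Proof. by move=> a x y; congr pair; rewrite /= scaler0 addr0. Qed.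
HB.instance Definition _ := GRing.isLinear.Build R V cplx *:%R cplx_in
  cplx_in_linear.

Lemma cplx_in_lie x y : cplx_in (lie x y) = lie (cplx_in x) (cplx_in y).
Proof. by congr pair; rewrite /= ?linear0r ?linear0l ?subr0 ?addr0. Qed.

Definition cext (f : 'End(V)) (z : cplx) : cplx := (f z.1, f z.2).

Fact cext_linear f : linear (cext f).
Proof. by move=> a z w; congr pair; rewrite /= linearP. Qed.
HB.instance Definition _ f := GRing.isLinear.Build R cplx cplx *:%R (cext f)
  (cext_linear f).

Lemma cext_in f x : cext f (cplx_in x) = cplx_in (f x).
Proof. by congr pair; rewrite /= linear0. Qed.

Lemma cext_cscale f a z : cext f (cscale a z) = cscale a (cext f z).
Proof. by congr pair; rewrite /= !(linearB, linearD, linearZ). Qed.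

End Complexification.

Lemma lfun_trace_comp (K : fieldType) (U V : vectType K)
  (f : 'Hom(U, V)) (g : 'Hom(V, U)) : lfun_trace (g \o f) = lfun_trace (f \o g).
Proof.
by rewrite /lfun_trace !(mxof_comp _ _ (vbasisP _)) mxtrace_mulC.
Qed.

Lemma lfun_traceD (K : fieldType) (V : vectType K) (f g : 'End(V)) :
  lfun_trace (f + g) = lfun_trace f + lfun_trace g.
Proof. by rewrite /lfun_trace linearD mxtraceD. Qed.

Lemma lfun_traceN (K : fieldType) (V : vectType K) (f : 'End(V)) :
  lfun_trace (- f) = - lfun_trace f.
Proof. by rewrite /lfun_trace linearN raddfN. Qed.

Section Dual.
Variables (R : realType) (P : ncSymPair R).
Local Notation theta := (pair_theta P).
Local Notation sigma := (pair_sigma P).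

(* g0^theta + sqrt(-1) g0^(-theta), inside the complexification of g0. *)
Definition dual_space : {vspace cplx P} :=
  (linfun (@cplx_in R P) @: leigenspace theta 1
   + (linfun (cscale 'i%C) \o linfun (@cplx_in R P))
       @: leigenspace theta (- 1))%VS.

Lemma mem_dual_space (z : cplx P) :
  (z \in dual_space) = (theta z.1 == z.1) && (theta z.2 == - z.2).
Proof.
have eigE a x : (x \in leigenspace theta a) = (theta x == a *: x).
  by rewrite memv_ker add_lfunE opp_lfunE scale_lfunE id_lfunE subr_eq0.
apply/idP/andP.
  case/memv_addP=> u /memv_imgP[x]; rewrite eigE scale1r => /eqP Ex ->.
  case=> v /memv_imgP[y]; rewrite eigE scaleN1r => /eqP Ey -> ->.
  rewrite !lfunE /= !lfunE /= /cscale /cplx_in /= scale0r !scaler0.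
  by rewrite subr0 !addr0 !add0r scale1r Ex Ey !eqxx.
case: z => x y [/= /eqP Ex /eqP Ey].
apply/memv_addP; exists (cplx_in x).
  by rewrite -[cplx_in x]lfunE memv_img // eigE scale1r Ex.
exists (cscale 'i%C (cplx_in y)).
  apply/memv_imgP; exists y; first by rewrite eigE scaleN1r Ey.
  by rewrite !lfunE /= !lfunE.
by rewrite /cscale /cplx_in; congr pair;
  rewrite /= ?scale0r ?scale1r ?scaler0 ?subr0 ?addr0 ?add0r.
Qed.

Lemma theta_lie x y : theta (lie x y) = lie (theta x) (theta y).
Proof. by case: (pair_theta_cartan P) => -[[_ ->]]. Qed.

Lemma thetaK x : theta (theta x) = x.
Proof.
case: (pair_theta_cartan P) => -[_ /lfunP/(_ x)] /=.
by rewrite comp_lfunE id_lfunE.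
Qed.

Lemma sigma_lie x y : sigma (lie x y) = lie (sigma x) (sigma y).
Proof. by case: (pair_sigma_inv P) => -[_ ->]. Qed.

Lemma sigmaK x : sigma (sigma x) = x.
Proof.
by case: (pair_sigma_inv P) => _ /lfunP/(_ x); rewrite comp_lfunE id_lfunE.
Qed.

Lemma theta_sigma x : theta (sigma x) = sigma (theta x).
Proof. by move/lfunP/(_ x): (pair_commute P); rewrite !comp_lfunE. Qed.

Lemma dual_closed : lie_closed dual_space.
Proof.
move=> [x1 x2] [y1 y2]; rewrite !mem_dual_space /=.
move=> /andP[/eqP x1P /eqP x2P] /andP[/eqP y1P /eqP y2P].
rewrite linearB linearD /= !theta_lie x1P x2P y1P y2P.
by rewrite !(linearNl, linearNr) /= opprK opprD !eqxx.
Qed.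

Definition dual_alg : lieAlgType R := subalg dual_closed.

(* The restriction to the dual of the complex-linear extension of f; see
   val_dual_restr. *)
Definition dual_restr (f : 'End(P)) : 'End(dual_alg) :=
  linfun (vsproj dual_space \o cext f \o @vsval _ _ dual_space).

Lemma val_dual_restr f (u : dual_alg) : theta \o f = f \o theta ->
  vsval (dual_restr f u) = cext f (vsval u).
Proof.
move=> /lfunP thf; have {}thf x : theta (f x) = f (theta x).
  by have := thf x; rewrite !comp_lfunE.
rewrite lfunE /= vsprojK // mem_dual_space /= !thf.
have := subvsP u; rewrite mem_dual_space => /andP[/eqP-> /eqP->].
by rewrite linearN !eqxx.
Qed.

Definition dual_theta1 : 'End(dual_alg) := dual_restr theta.
Definition dual_theta2 : 'End(dual_alg) := dual_restr sigma.

Lemma dual_restr_involution f :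
  theta \o f = f \o theta -> lie_involution f -> lie_involution (dual_restr f).
Proof.
move=> thf [[_ fL] /lfunP fK].
have fK2 : cancel (dual_restr f) (dual_restr f).
  move=> u; apply: subvs_inj; rewrite !val_dual_restr //.
  have {}fK x : f (f x) = x by have := fK x; rewrite comp_lfunE id_lfunE.
  by case: (vsval u) => x y; rewrite /cext /= !fK.
split; last by apply/lfunP=> u; rewrite comp_lfunE id_lfunE fK2.
split; first by exists (dual_restr f).
move=> u v; apply: subvs_inj.
rewrite val_dual_restr // !val_sub_lie !val_dual_restr //.
by congr pair; rewrite /= ?(linearB, linearD) /= !fL.
Qed.

Lemma dual_theta1_involution : lie_involution dual_theta1.
Proof.
by apply: dual_restr_involution => //; case: (pair_theta_cartan P).
Qed.

Lemma dual_theta2_involution : lie_involution dual_theta2.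
Proof.
by apply: dual_restr_involution (pair_commute P) (pair_sigma_inv P).
Qed.

Lemma dual_commute : dual_theta1 \o dual_theta2 = dual_theta2 \o dual_theta1.
Proof.
apply/lfunP=> u; apply: subvs_inj; rewrite !comp_lfunE.
rewrite !val_dual_restr ?(pair_commute P) //.
by rewrite /cext /= !theta_sigma.
Qed.

Definition dual_sum (u : dual_alg) : P := (vsval u).1 + (vsval u).2.

Fact dual_sum_linear : linear dual_sum.
Proof. by move=> a u v; rewrite /dual_sum /= scalerDr addrACA. Qed.
HB.instance Definition _ := GRing.isLinear.Build R dual_alg P *:%R dual_sum
  dual_sum_linear.

Lemma dual_sum_iso (f : 'End(dual_alg)) (h : 'End(P)) :
  (forall u, dual_sum (f u) = h (dual_sum u)) -> lfun_trace f = lfun_trace h.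
Proof.
move=> fh; pose S := linfun dual_sum.
have two : (2%:R : R) != 0 by rewrite pnatr_eq0.
have S_full : limg S = fullv.
  apply/vspaceP=> x; rewrite memvf; apply/memv_imgP.
  pose z : cplx P := (2%:R^-1 *: (x + theta x), 2%:R^-1 *: (x - theta x)).
  have zP : z \in dual_space.
    rewrite mem_dual_space /= -scalerN opprB ![theta (_ *: _)]linearZ /=.
    rewrite [theta (x + _)]linearD [theta (x - _)]linearB /= thetaK.
    by rewrite [theta x + x]addrC !eqxx.
  exists (vsproj dual_space z); first by rewrite memvf.
  rewrite lfunE /= /dual_sum vsprojK //= -scalerDr addrACA subrr addr0.
  by rewrite -mulr2n -scaler_nat scalerA mulVf // scale1r.
have S_inj : lker S == 0%VS.
  apply/lker0P=> u v; rewrite !lfunE /= /dual_sum.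
  have := subvsP v; have := subvsP u; rewrite !mem_dual_space.
  case Eu: (vsval u) => [p q] /= /andP[/eqP pP /eqP qP].
  case Ev: (vsval v) => [p' q'] /= /andP[/eqP p'P /eqP q'P] E.
  have := congr1 theta E; rewrite !linearD /= pP qP p'P q'P => E'.
  have {E'} Ep : p = p'.
    have : p + q + (p - q) = p' + q' + (p' - q') by rewrite E E'.
    rewrite [p + q + _]addrACA [p' + q' + _]addrACA !subrr !addr0 -!mulr2n -!scaler_nat.
    by move/(scalerI two).
  apply: subvs_inj; rewrite Eu Ev Ep; congr pair.
  by move: E; rewrite Ep => /addrI.
have -> : f = (S^-1 \o (h \o S))%VF.
  apply/lfunP=> u; rewrite !comp_lfunE [S u]lfunE -fh -[dual_sum _]lfunE.
  by rewrite lker0_lfunK.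
rewrite lfun_trace_comp -comp_lfunA; congr lfun_trace.
apply/lfunP=> x; rewrite !comp_lfunE limg_lfunVK //.
by rewrite S_full memvf.
Qed.

Lemma dual_killing (u : dual_alg) :
  killing u u = killing (vsval u).1 (vsval u).1
              - killing (vsval u).2 (vsval u).2.
Proof.
have := subvsP u; rewrite mem_dual_space; case Eu: (vsval u) => [p q] /=.
move=> /andP[/eqP pP /eqP qP].
pose h := ad p + (ad q \o theta)%VF.
have uh v : dual_sum (ad u v) = h (dual_sum v).
  rewrite adE /dual_sum /= val_sub_lie Eu /=.
  rewrite add_lfunE comp_lfunE !adE /=.
  have := subvsP v; rewrite mem_dual_space => /andP[/eqP v1 /eqP v2].
  rewrite !linearD /= v1 v2 linearNr.
  by rewrite addrACA [- _ + _]addrC.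
have th_p : (theta \o ad p = ad p \o theta)%VF.
  by apply/lfunP=> x; rewrite !comp_lfunE !adE theta_lie pP.
have th_q : (theta \o ad q = - (ad q \o theta))%VF.
  apply/lfunP=> x; rewrite opp_lfunE !comp_lfunE !adE theta_lie qP.
  by rewrite linearNl.
have th2 : (theta \o theta = \1)%VF.
  by apply/lfunP=> x; rewrite comp_lfunE id_lfunE thetaK.
have uhh v : dual_sum ((ad u \o ad u)%VF v) = (h \o h)%VF (dual_sum v).
  by rewrite !comp_lfunE !uh.
rewrite /killing (dual_sum_iso uhh).
rewrite /h comp_lfunDl !comp_lfunDr !lfun_traceD.
have -> : (ad q \o theta \o (ad q \o theta) = - (ad q \o ad q))%VF.
  rewrite comp_lfunA -(comp_lfunA _ theta) th_q comp_lfunNr comp_lfunNl.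
  by rewrite -!comp_lfunA th2 comp_lfun1r.
have cross : lfun_trace (ad p \o (ad q \o theta)) = 0.
  have : lfun_trace (ad p \o (ad q \o theta))
         = lfun_trace (theta \o ad p \o ad q).
    by rewrite comp_lfunA lfun_trace_comp comp_lfunA.
  rewrite th_p -comp_lfunA th_q comp_lfunNr lfun_traceN => /eqP.
  by rewrite -addr_eq0 -mulr2n mulrn_eq0 => /eqP.
rewrite [lfun_trace (ad q \o theta \o ad p)]lfun_trace_comp cross.
by rewrite add0r addr0 lfun_traceN.
Qed.

Lemma dual_compact : compact_alg dual_alg.
Proof.
move=> u u_neq0; rewrite dual_killing.
have := subvsP u; rewrite mem_dual_space => /andP[/eqP u1 /eqP u2].
have killing0 : @killing R P 0 0 = 0.
  rewrite /killing (_ : ad 0 = 0) ?comp_lfun0l ?/lfun_trace ?linear0 //.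
  by apply/lfunP=> x; rewrite adE linear0l zero_lfunE.
have killingN x y : @killing R P x (- y) = - killing x y.
  rewrite /killing (_ : ad (- y) = - ad y) ?comp_lfunNr ?lfun_traceN //.
  by apply/lfunP=> z; rewrite opp_lfunE !adE linearNl.
have [_ pos] := pair_theta_cartan P.
have [p0|/pos] := eqVneq (vsval u).1 0; rewrite ?u1.
  rewrite p0 killing0 sub0r oppr_lt0.
  have [q0|/pos] := eqVneq (vsval u).2 0; last by rewrite u2 killingN opprK.
  case/eqP: u_neq0; apply: subvs_inj.
  by rewrite [LHS]surjective_pairing p0 q0.
have [->|/pos] := eqVneq (vsval u).2 0.
  by rewrite killing0 subr0 oppr_gt0.
rewrite u2 killingN opprK => q_gt0 p_lt0; rewrite subr_lt0.
by apply: lt_trans q_gt0; rewrite -oppr_gt0.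
Qed.

Lemma dual_semisimple : semisimple dual_alg.
Proof.
move=> u u_perp; apply/eqP/contraT => /dual_compact.
by rewrite u_perp ltxx.
Qed.

Definition dual : compactTriad R :=
  CompactTriad dual_semisimple dual_compact
    dual_theta1_involution dual_theta2_involution dual_commute.

End Dual.

(* Main.v *)
From HB Require Import structures.
Require Import Defs.
From mathcomp Require Import all_boot all_order all_algebra.
From mathcomp Require Import reals.

(** The ideals on the two sides correspond to each other, but a priori the dual
triad asks for stability under one more involution: a sigma-invariant ideal of
g0 has to be compared with an ideal of g stable under theta1 and theta2.  Two
facts make the comparison work.

Every ideal of g0 is automatically theta-stable ([cartan_ideal_invariant]).
For simple summands this is clear: if theta moved a summand to another one,
then x and theta x would commute and be Killing-orthogonal for x in it, against
the positivity of - B(x, theta x).  The proof below runs this argument without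
decomposing g0.  For an ideal I put K = I :&: theta I, a theta-stable ideal,
and let L be the part of I orthogonal to K, again an ideal.  Positivity gives
K :&: L = 0, hence [L, theta L] = 0, hence B(x, theta x) = 0 on L and L = 0.
So I has no more dimensions than K, that is, I = K.

The real-linear bijection S : p + i q |-> p + q from g to g0 ([dual_sum]) carries
theta1 to theta and theta2 to sigma.  It is no Lie algebra morphism, since
[i q, i q'] = - [q, q'], but the sign is exactly an application of theta:
S [p + i q, v] = [p, S v] + [q, theta (S v)] ([dual_sum_lie]).  Therefore S and
its inverse carry theta-stable ideals to theta-stable ideals, and irreducibility
passes both ways. *)

Set Implicit Arguments.
Unset Strict Implicit.
Unset Printing Implicit Defensive.

Import Order.TTheory GRing.Theory Num.Theory.
Import passmx.
Local Open Scope ring_scope.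
Local Open Scope lfun_scope.

(** * Invariance and orthogonality for the Killing form *)

Section KillingForm.
Variables (K : fieldType) (V : lieAlgType K).
Implicit Types (x y z : V) (I J : {vspace V}) (nu : 'End(V)).

Lemma ad_lie x y : ad (lie x y) = (ad x \o ad y) - (ad y \o ad x).
Proof.
apply/lfunP=> z; rewrite add_lfunE opp_lfunE !comp_lfunE !adE.
have /eqP := lie_jacobi x y z.
rewrite [lie z x]lie_anti linearNr [lie z _]lie_anti subr_eq0 => /eqP <-.
by [].
Qed.

Lemma killingC x y : killing x y = killing y x.
Proof. exact: lfun_trace_comp. Qed.

Lemma killing_linear x : scalar (killing x).
Proof.
move=> a y z; rewrite /killing.
have -> : ad (a *: y + z) = a *: ad y + ad z.
  by apply/lfunP=> t; rewrite add_lfunE scale_lfunE !adE linearPl.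
rewrite comp_lfunDr -comp_lfunZr.
by rewrite /lfun_trace mxof_linear mxtraceD mxtraceZ.
Qed.
HB.instance Definition _ x :=
  GRing.isLinear.Build K V K *%R (killing x) (killing_linear x).

Lemma killing_lie x y z : killing (lie x y) z = killing x (lie y z).
Proof.
rewrite /killing !ad_lie comp_lfunDl comp_lfunDr !lfun_traceD comp_lfunNl.
rewrite comp_lfunNr !lfun_traceN -!comp_lfunA; congr (_ - _).
by rewrite [LHS]lfun_trace_comp comp_lfunA.
Qed.

(** The orthogonal of J is presented as the kernel of a map to a space of
dimension dim J, so that rank-nullity bounds its codimension even when the
form is degenerate. *)
Definition killing_coord J x : 'rV[K]_(\dim J) :=
  \row_i killing (vbasis J)`_i x.

Fact killing_coord_linear J : linear (killing_coord J).
Proof. by move=> a x y; apply/rowP=> i; rewrite !mxE killing_linear. Qed.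
HB.instance Definition _ J :=
  GRing.isLinear.Build K V 'rV[K]_(\dim J) *:%R (killing_coord J)
    (killing_coord_linear J).

Definition killing_perp J : {vspace V} := lker (linfun (killing_coord J)).

Lemma killing_perpP J x :
  reflect (forall y, y \in J -> killing x y = 0) (x \in killing_perp J).
Proof.
rewrite memv_ker lfunE /=; apply: (iffP eqP) => [x0 y /coord_vbasis-> | xJ].
  rewrite linear_sum big1 //= => i _.
  have /rowP/(_ i) := x0; rewrite !mxE killingC => xi.
  by rewrite linearZ /= xi mulr0.
apply/rowP=> i; rewrite !mxE killingC xJ // vbasis_mem // mem_nth //.
by rewrite size_tuple.
Qed.

Lemma killing_perp_ideal J : ideal J -> ideal (killing_perp J).
Proof.
move=> idJ x y /killing_perpP yJ; apply/killing_perpP=> z zJ.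
by rewrite killingC -killing_lie killingC yJ // lie_anti memvN idJ.
Qed.

(** When I :&: killing_perp J = 0, the map [killing_coord J] is injective
on I. *)
Lemma dim_perp0 I J :
  (I :&: killing_perp J = 0)%VS -> (\dim I <= \dim J)%N.
Proof.
move=> IJ; have := limg_ker_dim (linfun (killing_coord J)) I.
rewrite -/(killing_perp J) IJ dimv0 add0n => <-.
by apply: leq_trans (dimvS (subvf _)) _; rewrite dimvf /dim /= mul1n.
Qed.

Lemma ideal_cap I J : ideal I -> ideal J -> ideal (I :&: J)%VS.
Proof.
move=> idI idJ x y; rewrite !memv_cap => /andP[yI yJ].
by rewrite idI ?idJ.
Qed.

Lemma ideal_img nu I : lie_automorphism nu -> ideal I -> ideal (nu @: I)%VS.
Proof.
move=> [[mu _ muK] nuL] idI x _ /memv_imgP[y yI ->].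
by rewrite -(muK x) -nuL memv_img // idI.
Qed.

Lemma lie_ideals I J x y : ideal I -> ideal J ->
  x \in I -> y \in J -> lie x y \in (I :&: J)%VS.
Proof.
by move=> idI idJ xI yJ; rewrite memv_cap idJ // lie_anti memvN idI.
Qed.

Lemma lie_involutionK nu : lie_involution nu -> involutive nu.
Proof. by case=> _ /lfunP nuK x; rewrite -[RHS]id_lfunE -nuK comp_lfunE. Qed.

End KillingForm.

(** * Ideals are stable under Cartan involutions *)

Section CartanInvolution.
Variables (R : realType) (V : lieAlgType R) (theta : 'End(V)).
Hypothesis cartan : cartan_involution theta.

Lemma cartan_killing0 x : killing x (theta x) = 0 -> x = 0.
Proof.
move=> x0; apply/eqP/contraT => /(proj2 cartan).
by rewrite x0 oppr0 ltxx.
Qed.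

(** With K and L as in the proof: for x and y in L, the bracket [x, theta y] lies
in I :&: theta I = K and also in L, so it vanishes.  Since [theta x, z] lies in
theta L for every z, this gives ad x \o ad (theta x) = 0, hence
B(x, theta x) = 0 and x = 0. *)
Lemma cartan_ideal_invariant (I : {vspace V}) : ideal I -> Defs.invariant theta I.
Proof.
move=> idI; have [thI _] := cartan; have thK := lie_involutionK thI.
have [thA _] := thI; have thL := proj2 thA.
have memI x : (theta x \in (theta @: I)%VS) = (x \in I).
  apply/idP/idP; last exact: memv_img.
  by case/memv_imgP=> y yI /(congr1 theta); rewrite !thK => ->.
pose K := (I :&: (theta @: I))%VS.
have thetaK_mem x : x \in K -> theta x \in K.
  rewrite !memv_cap memI => /andP[xI]; rewrite xI andbT.
  by rewrite -{1}[x]thK memI.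
have idK : ideal K by apply: ideal_cap idI (ideal_img thA idI).
pose L := (I :&: killing_perp K)%VS.
have idL : ideal L by apply: ideal_cap idI (killing_perp_ideal idK).
have KL0 x : x \in K -> x \in L -> x = 0.
  move=> xK; rewrite memv_cap => /andP[_ /killing_perpP xp].
  by apply: cartan_killing0; apply/xp/thetaK_mem.
have L0 : L = 0%VS.
  apply/eqP; rewrite -subv0; apply/subvP=> x xL; rewrite memv0; apply/eqP.
  apply: cartan_killing0; rewrite /killing.
  suff -> : ad x \o ad (theta x) = 0 by rewrite /lfun_trace !linear0.
  apply/lfunP=> z; rewrite comp_lfunE !adE zero_lfunE.
  have -> : lie (theta x) z = theta (lie x (theta z)) by rewrite thL thK.
  have yL : lie x (theta z) \in L by rewrite lie_anti memvN idL.
  have [yI _] := memv_capP yL; have [xI _] := memv_capP xL.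
  apply: KL0; first by apply: lie_ideals (ideal_img thA idI) xI _; rewrite ?memI.
  by rewrite lie_anti memvN idL.
have KI : K = I.
  by apply/eqP; rewrite eqEdim capvSl dim_perp0.
by apply/subvP=> _ /memv_imgP[x xI ->]; rewrite -KI thetaK_mem // KI.
Qed.

End CartanInvolution.

(** * Transport of ideals between a pair and its dual *)

Section DualIdeals.
Variables (R : realType) (P : ncSymPair R).
Local Notation theta := (pair_theta P).
Local Notation sigma := (pair_sigma P).
Local Notation S := (linfun (@dual_sum R P)).
Implicit Types (u v : dual_alg P) (x y : P).

Lemma dual_sumE u : S u = (vsval u).1 + (vsval u).2.
Proof. by rewrite lfunE. Qed.

Lemma dual_valP u : theta (vsval u).1 = (vsval u).1
                 /\ theta (vsval u).2 = - (vsval u).2.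
Proof. by have := subvsP u; rewrite mem_dual_space => /andP[/eqP ? /eqP]. Qed.

Lemma mem_dual_pair x y : theta x = x -> theta y = - y ->
  ((x, y) : cplx P) \in dual_space P.
Proof. by move=> xP yP; rewrite mem_dual_space /= xP yP !eqxx. Qed.

Lemma dual_sum_theta u : S (dual_theta1 P u) = theta (S u).
Proof. by rewrite !dual_sumE val_dual_restr // linearD. Qed.

Lemma dual_sum_sigma u : S (dual_theta2 P u) = sigma (S u).
Proof. by rewrite !dual_sumE val_dual_restr ?(pair_commute P) // linearD. Qed.

(** The bracket of g is that of g0 up to the sign in [i q, i q'] = - [q, q'];
applying theta to S v supplies this sign, as theta fixes the first component of
v and negates the second. *)
Lemma dual_sum_lie u v :
  S (lie u v) = lie (vsval u).1 (S v) + lie (vsval u).2 (theta (S v)).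
Proof.
have [v1 v2] := dual_valP v.
rewrite !dual_sumE val_sub_lie /= !linearD /= v1 v2 linearNr.
by rewrite addrACA [- _ + _]addrC.
Qed.

(** The components are the theta-eigencomponents of the sum, so they can be
read off from S u and theta (S u). *)
Lemma dual_sum_ker : lker S = 0%VS.
Proof.
apply/eqP; rewrite -subv0; apply/subvP=> u; rewrite memv_ker memv0 => /eqP u0.
have [u1 u2] := dual_valP u.
have E := u0; rewrite dual_sumE in E.
have E' := congr1 theta E; rewrite linearD linear0 /= u1 u2 in E'.
have /eqP : (vsval u).1 *+ 2 = 0.
  by rewrite -(addr0 0) -{1}E -E' addrACA subrr addr0.
rewrite -scaler_nat scaler_eq0 pnatr_eq0 /= => /eqP p0; move: E; rewrite p0 add0r => q0.
by apply/eqP/subvs_inj; rewrite [LHS]surjective_pairing p0 q0.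
Qed.

Lemma dual_sum_surj x : exists u, S u = x.
Proof.
pose z : cplx P := (2%:R^-1 *: (x + theta x), 2%:R^-1 *: (x - theta x)).
have zP : z \in dual_space P.
  apply: mem_dual_pair; rewrite linearZ /=.
    by rewrite linearD /= thetaK addrC.
  by rewrite linearB /= thetaK -scalerN opprB.
exists (vsproj _ z); rewrite dual_sumE vsprojK //= -scalerDr addrACA subrr addr0.
by rewrite -mulr2n -scaler_nat scalerA mulVf ?scale1r ?pnatr_eq0.
Qed.

Lemma dual_sum_preim_ideal (I : {vspace P}) :
  ideal I -> Defs.invariant theta I -> ideal (S @^-1: I)%VS.
Proof.
move=> idI thI u v; rewrite -!memv_preim dual_sum_lie => vI.
by rewrite memvD ?idI // (subvP thI) // memv_img.
Qed.

(** To get the bracket of g0 from brackets of g, the sign of [dual_sum_lie] is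
undone by applying theta1 to v before bracketing with i q; stability of J under
theta1 keeps the result in J. *)
Lemma dual_sum_img_ideal (J : {vspace dual_alg P}) :
  ideal J -> Defs.invariant (dual_theta1 P) J -> ideal (S @: J)%VS.
Proof.
move=> idJ thJ x _ /memv_imgP[v vJ ->]; have [u <-] := dual_sum_surj x.
have [u1 u2] := dual_valP u.
pose up : dual_alg P := vsproj _ ((vsval u).1, 0).
pose uq : dual_alg P := vsproj _ (0, (vsval u).2).
have upE : vsval up = ((vsval u).1, 0).
  by rewrite vsprojK ?mem_dual_pair // linear0 oppr0.
have uqE : vsval uq = (0, (vsval u).2).
  by rewrite vsprojK ?mem_dual_pair // linear0.
have -> : lie (S u) (S v) = S (lie up v + lie uq (dual_theta1 P v)).
  rewrite linearD /= !dual_sum_lie upE uqE /= dual_sum_theta thetaK.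
  by rewrite !linear0l addr0 add0r dual_sumE linearDl.
by rewrite memv_img // memvD ?idJ // (subvP thJ) // memv_img.
Qed.

End DualIdeals.

Theorem theorem4p16 (R : realType) (P : ncSymPair R) :
  irreducible_pair P <-> irreducible_triad (dual P).
Proof.
pose S := linfun (@dual_sum R P).
have S0 : lker S == 0%VS by rewrite dual_sum_ker.
have ST : limg S = fullv.
  apply/vspaceP=> x; rewrite memvf; have [u <-] := dual_sum_surj x.
  by rewrite memv_img ?memvf.
split=> irr.
  move=> J idJ th1 th2.
  have [] := irr (S @: J)%VS.
  - exact: dual_sum_img_ideal.
  - apply/subvP=> _ /memv_imgP[_ /memv_imgP[u uJ ->] ->].
    by rewrite -dual_sum_sigma memv_img // (subvP th2) // memv_img.
  - move/eqP; rewrite -subv0 -[0%VS](limg0 S) limg_ker0 // subv0 => /eqP.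
    by left.
  - rewrite -ST => /eqP; rewrite eqEsubv !limg_ker0 // -eqEsubv => /eqP.
    by right.
move=> I idI sI.
have thI : Defs.invariant (pair_theta P) I.
  by apply: cartan_ideal_invariant => //; apply: pair_theta_cartan.
have SK : (S @: (S @^-1: I))%VS = I by rewrite lpreimK // ST subvf.
have [] := irr (S @^-1: I)%VS.
- exact: dual_sum_preim_ideal.
- apply/subvP=> _ /memv_imgP[u uI ->].
  rewrite -memv_preim in uI.
  by rewrite -memv_preim dual_sum_theta (subvP thI) // memv_img.
- apply/subvP=> _ /memv_imgP[u uI ->].
  rewrite -memv_preim in uI.
  by rewrite -memv_preim dual_sum_sigma (subvP sI) // memv_img.
- by move=> I0; left; rewrite -SK I0 limg0.
- by move=> IT; right; rewrite -SK IT.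
Qed.
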